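(* Let $p_1=\frac12$ and $p_n=\frac1n$ for $n\ge 2$, let $(Y_n)_{n\ge1}$ be the centred coin turning process with turning probabilities $(p_n)$, and let $S_N=Y_1+\dots+Y_N$. Then the law of $S_N/N$ converges weakly to the uniform distribution on $[-1,1]$ as $N\to\infty$.
   Context: Given a deterministic sequence $(p_n)_{n\ge1}$ in $[0,1]$ with $p_1=\frac12$, let $W_1,W_2,\dots$ be independent Bernoulli random variables with $P(W_n=1)=p_n$. The centred coin turning process is $Y_n:=(-1)^{\sum_{k=1}^n W_k}\in\{-1,+1\}$, $n\ge 1$. Equivalently, $Y_1=\pm1$ with probability $\frac12$ each, and for $n\ge2$, independently of the past, $Y_n=-Y_{n-1}$ with probability $p_n$ and $Y_n=Y_{n-1}$ with probability $1-p_n$. *)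

(* Defs.v *)
From HB Require Import structures.
From mathcomp Require Import all_boot all_order all_algebra finmap.
From mathcomp Require Import all_classical all_reals all_analysis.

Set Implicit Arguments.
Unset Strict Implicit.
Unset Printing Implicit Defensive.

Import Order.TTheory GRing.Theory Num.Theory.
Import numFieldNormedType.Exports.

Local Open Scope classical_set_scope.
Local Open Scope ring_scope.

Definition mutually_independent {d d' : measure_display} {T : measurableType d}
    {T' : measurableType d'} {R : realType} (P : probability T R)
    {I : choiceType} (D : set I) (X : I -> {RV P >-> T'}) : Prop :=
  forall (J : {fset I}) (A : I -> set T'),
    [set` J] `<=` D -> (forall i, i \in J -> measurable (A i)) ->
    P (\bigcap_(i in [set` J]) (X i @^-1` A i)) =
    (\prod_(i <- J) P (X i @^-1` A i))%E.

(* The sequences [p] and [W] of the model start at index 1; index 0 is never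
   used. *)
Definition turning_variables {d : measure_display} {T : measurableType d}
    {R : realType} (P : probability T R) (p : nat -> R)
    (W : nat -> {RV P >-> bool}) : Prop :=
  mutually_independent [set n | (1 <= n)%N] W /\
  (forall n, (1 <= n)%N -> P [set t | W n t = true] = (p n)%:E).

Section coin_turning_process.
Context {d : measure_display} {T : measurableType d} {R : realType}.
Context {P : probability T R}.
Variable W : nat -> {RV P >-> bool}.

Definition coin_turning (n : nat) (t : T) : R :=
  (-1) ^+ (\sum_(1 <= k < n.+1) W k t)%N.

Definition coin_turning_sum (N : nat) (t : T) : R :=
  \sum_(1 <= n < N.+1) coin_turning n t.

(* [measurableTypeR R] is [R] with its Borel sets, in the display used by the
   library for [lebesgue_measure] and [uniform_prob]. *)
Definition coin_turning_mean (N : nat) : T -> measurableTypeR R :=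
  fun t => coin_turning_sum N t / N%:R.

Lemma measurable_coin_turning n : measurable_fun [set: T] (coin_turning n).
Proof.
rewrite (_ : coin_turning n =
    fun t => \prod_(k <- index_iota 1 n.+1) (-1) ^+ W k t); last first.
  by apply/funext => t; rewrite /coin_turning expr_sum.
apply: measurable_prod => k _.
apply: (measurableT_comp (f := fun b : bool => (-1) ^+ b : R)) => //.
Qed.

Lemma measurable_coin_turning_mean N :
  measurable_fun [set: T] (coin_turning_mean N).
Proof.
have : measurable_fun [set: T] (fun t => coin_turning_sum N t / N%:R : R).
  apply: measurable_realfun.measurable_funM => //.
  by apply: measurable_sum => n; exact: measurable_coin_turning.
by [].
Qed.

HB.instance Definition _ N :=
  isMeasurableFun.Build _ _ _ _ (coin_turning_mean N)
    (measurable_coin_turning_mean N).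

End coin_turning_process.

Definition weak_cvg {R : realType} (mu : nat -> probability (measurableTypeR R) R)
    (nu : probability (measurableTypeR R) R) : Prop :=
  forall f : R -> R, continuous f -> bounded_fun f ->
    (\int[mu n]_x (f x)%:E)%E @[n --> \oo] --> (\int[nu]_x (f x)%:E)%E.

Definition harmonic_turning {R : realType} (n : nat) : R :=
  if n == 1%N then 2^-1 else n%:R^-1.

Lemma ltrN11 (R : numDomainType) : -1 < 1 :> R.
Proof. exact: lt_trans (ltrN10 R) ltr01. Qed.

(* Main.v *)
(* If H_N counts the times n <= N with Y_n = 1, then S_N = 2 H_N - N, and the
   pair (H_N, Y_N) is a Markov chain whose law is explicit for the turning
   probabilities 1/n:
     P(H_N = h, Y_N = 1) = (2h - 1) / (2 N (N - 1))   for 0 < h < N,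
   with the values 0 at h = 0 and 1 / (2N) at h = N, and
   P(H_N = h, Y_N = -1) = P(H_N = N - h, Y_N = 1).  Hence P(H_N = h) is 1/N for
   0 < h < N and 1 / (2N) for h = 0 and h = N, so that E f(S_N / N) is exactly
   half the trapezoidal sum of f on [-1, 1] with N equal cells. *)
Require Import Defs.
From mathcomp Require Import all_boot all_order all_algebra finmap.
From mathcomp Require Import all_classical all_reals all_analysis.
From mathcomp Require Import ring lra zify measurable_realfun.

Import Order.TTheory GRing.Theory Num.Theory.
Import numFieldNormedType.Exports.

Local Open Scope classical_set_scope.
Local Open Scope ring_scope.

(** * Convergence of the trapezoidal rule *)

(** The near-covering form of compactness merges the radii found at the single points of [K] into
    one. *)
Lemma compact_unif_continuous {R : realType} (f : R -> R) (K : set R) (e : R) :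
  compact K -> continuous f -> 0 < e ->
  exists2 r, 0 < r & forall x y, K x -> `|x - y| < r -> `|f x - f y| < e.
Proof.
move=> cK cf e0.
have /compact_near_coveringP/(_ _ (0 : R)^'+
    (fun r x => forall y, `|x - y| < r -> `|f x - f y| < e)) := cK.
case.
- move=> x _.
  have e20 : 0 < e / 2 by rewrite divr_gt0.
  have /cvgrPdist_lt/(_ _ e20) := cf x.
  rewrite nearE => /nbhs_ballP[r /= r0 Br].
  (* Halving the radius keeps [y] within [r] of [x], so that [f x'] and [f y] are both [e / 2]-close
     to [f x]. *)
  exists (ball x (r / 2), [set s | 0 < s < r / 2]) => /=.
    split; first by apply: nbhsx_ballx; rewrite divr_gt0.
    near=> s => /=; apply/andP; split => //.
    by near: s; apply: nbhs_right_lt; rewrite divr_gt0.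
  move=> [x' s] /= [xx' /andP[s0 sr]] y x'y.
  have rr2 : r / 2 < r by rewrite ltr_pdivrMr// ltr_pMr// ltr1n.
  have /Br/= h1 : ball x r x' by apply: le_ball xx'; exact: ltW.
  have /Br/= h2 : ball x r y.
    rewrite /ball/= in xx' *; rewrite (le_lt_trans (ler_distD x' _ _))//.
    by rewrite [ltRHS](splitr r) ltrD// (lt_trans x'y).
  rewrite (le_lt_trans (ler_distD (f x) _ _))// [ltRHS](splitr e) ltrD//.
  by rewrite distrC.
- move=> s [/= s0 sK].
  have : \forall r \near (0 : R)^'+, 0 < r /\
      K `<=` (fun x => forall y, `|x - y| < r -> `|f x - f y| < e).
    apply: filterI; first exact: nbhs_right_gt.
    by exists s.
  by move=> /filter_ex[r [r0 rK]]; exists r => // x y /rK; exact.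
Unshelve. all: by end_near. Qed.

(** This is the mean value theorem for the primitive [F], whose derivative inside the interval is
    [f] by the fundamental theorem of calculus. *)
Lemma mean_value_integral {R : realType} (f : R -> R) (a b x y : R) :
  continuous f -> a <= x -> x < y -> y <= b ->
  exists2 c, c \in `]x, y[%R &
    (\int[lebesgue_measure]_(t in `[a, y]) f t)%R -
    (\int[lebesgue_measure]_(t in `[a, x]) f t)%R = f c * (y - x).
Proof.
move=> cf ax xy yb.
pose F u := (\int[lebesgue_measure]_(t in `[a, u]) f t)%R.
have intf u : lebesgue_measure.-integrable `[a, u] (EFin \o f).
  apply: continuous_compact_integrable; first exact: segment_compact.
  exact: continuous_subspaceT.
apply: (MVT (f := F)) => //.
- move=> z /[!in_itv]/= /andP[xz zy].
  have [dF <-] := @continuous_FTC1_closed _ f a z b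
    (lt_le_trans zy yb) (intf b) (le_lt_trans ax xz) (cf z).
  by rewrite derive1E; exact/derivableP.
- apply: (@continuous_subspaceW _ _ `[x, y] `[a, b] F).
    by apply: subset_itv; rewrite bnd_simp.
  apply: parameterized_integral_continuous => //.
  by rewrite (le_trans ax)// (le_trans (ltW xy)).
Qed.

(** The integral over a cell is the width times some [f c], and uniform continuity puts [f c] within
    [e / (b - a)] of [f] at both ends of the cell. So each of the [N] cells contributes an error of
    at most [e / N]. *)
Lemma trapezoid_cvg {R : realType} (f : R -> R) (a b : R) :
  continuous f -> a < b ->
  (b - a) / (2 * N%:R) *
    (\sum_(0 <= h < N) (f (a + (b - a) * h%:R / N%:R) +
                        f (a + (b - a) * h.+1%:R / N%:R)))
    @[N --> \oo] --> (\int[lebesgue_measure]_(x in `[a, b]) f x)%R.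
Proof.
move=> cf ab.
pose node N h : R := a + (b - a) * h%:R / N%:R.
have ba0 : 0 < b - a by rewrite subr_gt0.
apply/cvgrPdist_le => e e0.
have e'0 : 0 < e / (b - a) by rewrite divr_gt0.
have [r r0 fr] :=
  compact_unif_continuous f `[a, b] _ (@segment_compact _ a b) cf e'0.
have rba0 : 0 < r / (b - a) by rewrite divr_gt0.
near=> N.
have N0 : (0 < N)%N by near: N; exact: nbhs_infty_gt.
have N0R : 0 < N%:R :> R by rewrite ltr0n.
have Nr : (b - a) / N%:R < r.
  rewrite ltr_pdivrMr// mulrC -ltr_pdivrMr//.
  near: N; exact: nbhs_infty_gtr.
pose F x := (\int[lebesgue_measure]_(t in `[a, x]) f t)%R.
have nodeS h : node N h.+1 - node N h = (b - a) / N%:R.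
  by rewrite /node -natr1; field; rewrite gt_eqF.
have node0 : node N 0 = a by rewrite /node mulr0 mul0r addr0.
have nodeN : node N N = b by rewrite /node mulfK ?gt_eqF//; ring.
have leN h : a <= node N h by rewrite lerDl !mulr_ge0// ltW.
have geN h : (h <= N)%N -> node N h <= b.
  move=> hN; rewrite /node -lerBrDl ler_pdivrMr// ler_pM2l// ler_nat//.
have lt_nodeS h : node N h < node N h.+1 by rewrite -subr_gt0 nodeS divr_gt0.
have -> : (\int[lebesgue_measure]_(x in `[a, b]) f x)%R =
    \sum_(0 <= h < N) (F (node N h.+1) - F (node N h)).
  by rewrite telescope_sumr// nodeN node0 /F set_itv1 Rintegral_set1 subr0.
rewrite mulr_sumr -sumrB (le_trans (ler_norm_sum _ _ _))//.
have -> : e = \sum_(0 <= h < N) (e / N%:R).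
  by rewrite sumr_const_nat subn0 -[RHS]mulr_natr divfK// gt_eqF.
rewrite big_nat [leRHS]big_nat; apply: ler_sum => h /= hN.
have [c /[!in_itv]/= /andP[hc ch] ->] :=
  mean_value_integral f a b _ _ cf (leN h) (lt_nodeS h) (geN _ hN).
rewrite -/(node N h) -/(node N h.+1) nodeS.
have cab : `[a, b]%classic c.
  rewrite /= in_itv/= (le_trans (leN h) (ltW hc))/=.
  by rewrite (le_trans (ltW ch))// geN.
have chr : node N h.+1 - node N h < r by rewrite nodeS.
have /ltW f1 : `|f c - f (node N h)| < e / (b - a).
  apply: fr => //; rewrite gtr0_norm ?subr_gt0//.
  by rewrite (lt_trans _ chr)// ltrD2r.
have /ltW f2 : `|f c - f (node N h.+1)| < e / (b - a).
  apply: fr => //; rewrite ltr0_norm ?subr_lt0// opprB.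
  by rewrite (lt_trans _ chr)// ltrD2l ltrN2.
rewrite (_ : _ - _ = (b - a) / (2 * N%:R) *
  ((f c - f (node N h)) + (f c - f (node N h.+1)))); last first.
  by field; rewrite gt_eqF.
rewrite normrM gtr0_norm; last by rewrite divr_gt0// mulr_gt0.
rewrite [leRHS](_ : _ = (b - a) / (2 * N%:R) * (e / (b - a) + e / (b - a))).
  rewrite ler_wpM2l//; first by rewrite divr_ge0// ltW.
  by rewrite (le_trans (ler_normD _ _))// lerD.
by field; rewrite !gt_eqF.
Unshelve. all: by end_near. Qed.

(** * Integration against the uniform law *)

Lemma integral_uniform_prob {R : realType} (a b : R) (ab : a < b)
    (f : R -> R) : continuous f ->
  (\int[uniform_prob ab]_x (f x)%:E =
   ((b - a)^-1 * \int[lebesgue_measure]_(x in `[a, b]) f x)%:E)%E.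
Proof.
move=> cf.
have mf : measurable_fun [set: measurableTypeR R] (EFin \o f).
  by apply/measurable_EFinP; exact: continuous_measurable_fun.
have intf : lebesgue_measure.-integrable `[a, b] (EFin \o f).
  apply: continuous_compact_integrable; first exact: segment_compact.
  exact: continuous_subspaceT.
(* The density formula is applied to the positive and negative parts of [f]; integrability on the
   segment allows them to be recombined. *)
rewrite integralE !integral_uniform//; last 2 first.
  exact: measurable_funeneg.
  exact: measurable_funepos.
rewrite -muleBr//; last exact: integrable_add_def.
rewrite EFinM /Rintegral fineK; last exact: integrable_fin_num.
by congr (_ * _)%E; exact/esym/integralE.
Qed.

(** * Independence of one variable from events determined by others *)

(** The product formula is used twice: for [J], and for [J] with [m] added, where the family takes
    the value [B] at [m]. *)
Lemma mutually_independent_fsetU1 {d d' : measure_display}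
    {T : measurableType d} {T' : measurableType d'} {R : realType}
    {P : probability T R} {I : choiceType} (D : set I) (X : I -> {RV P >-> T'})
    (J : {fset I}) (m : I) (A : I -> set T') (B : set T') :
  mutually_independent D X -> D m -> [set` J] `<=` D -> m \notin J ->
  measurable B -> (forall i, i \in J -> measurable (A i)) ->
  P (X m @^-1` B `&` \bigcap_(i in [set` J]) (X i @^-1` A i)) =
  (P (X m @^-1` B) * P (\bigcap_(i in [set` J]) (X i @^-1` A i)))%E.
Proof.
move=> indX Dm JD mJ mB mA.
pose A' i := if i == m then B else A i.
have A'E i : i \in J -> A' i = A i.
  by move=> iJ; rewrite /A'; case: eqP iJ mJ => // -> ->.
have -> : X m @^-1` B `&` \bigcap_(i in [set` J]) (X i @^-1` A i) =
    \bigcap_(i in [set` (m |` J)%fset]) (X i @^-1` A' i).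
  rewrite bigcap_fsetU1 /A' eqxx; congr (_ `&` _).
  by apply: eq_bigcapr => i /= /A'E; rewrite /A' => ->.
rewrite !indX//; last first.
- move=> i /fset1UP[->|iJ]; rewrite /A' ?eqxx//.
  by case: ifP => // _; exact: mA.
- by move=> i /= /fset1UP[->|/JD].
rewrite big_fsetU1//= {1}/A' eqxx; congr (_ * _)%E.
by apply: eq_big_seq => i /A'E ->.
Qed.

(* [A] is a finite disjoint union of atoms, indexed by the set of the indices
   in [J] at which the variables are true. *)
Lemma mutually_independent_determined {d : measure_display}
    {T : measurableType d} {R : realType} {P : probability T R}
    {I : choiceType} (D : set I) (X : I -> {RV P >-> bool})
    (J : {fset I}) (m : I) (A : set T) (B : set bool) :
  mutually_independent D X -> D m -> [set` J] `<=` D -> m \notin J ->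
  (forall t t', {in J, forall i, X i t = X i t'} -> A t -> A t') ->
  measurable A /\ P (X m @^-1` B `&` A) = (P (X m @^-1` B) * P A)%E.
Proof.
move=> indX Dm JD mJ AJ.
pose trues t := [fset i in J | X i t]%fset.
pose atom (S : {fset I}) := \bigcap_(i in [set` J]) (X i @^-1` [set i \in S]).
have atomP S t : S \in fpowerset J -> atom S t <-> trues t = S.
  rewrite fpowersetE => /fsubsetP SJ; split=> [St|<- i /= iJ]; last first.
    by rewrite !inE/= iJ.
  apply/fsetP => i; rewrite !inE/=.
  have [iJ|iJ] := boolP (i \in J); first exact: St.
  by apply/esym/negbTE; apply: contra iJ; exact: SJ.
have truesJ t : trues t \in fpowerset J.
  by rewrite fpowersetE; apply/fsubsetP => i; rewrite !inE => /andP[].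
(* The atoms that meet [A] cover it, and they lie inside it because membership in [A] depends only
   on the variables in [J]. *)
have AE : A = \bigcup_(S in trues @` A) atom S.
  apply/seteqP; split=> [t At|t [_ [t' At' <-]] /(atomP _ _ (truesJ _)) tt'].
    by exists (trues t); [exists t|exact/(atomP _ _ (truesJ _))].
  apply: AJ At' => i iJ; move/fsetP : tt' => /(_ i).
  by rewrite !inE/= iJ/= => ->.
have finA : finite_set (trues @` A).
  apply: (sub_finite_set _ (finite_fset (fpowerset J))).
  by move=> _ [t _ <-]; exact: truesJ.
have matom S : measurable (atom S).
  apply: fin_bigcap_measurable; first exact: finite_fset.
  by move=> i _; rewrite -[X in measurable X]setTI; exact: measurable_funPT.
have tatom : trivIset (trues @` A) atom.
  move=> S S' [t _ tS] [t' _ tS'] [u []].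
  rewrite -tS -tS' => /(atomP _ _ (truesJ _)) <-.
  by move=> /(atomP _ _ (truesJ _)) <-.
have mXB : measurable (X m @^-1` B).
  by rewrite -[X in measurable X]setTI; exact: measurable_funPT.
split; first by rewrite AE; exact: fin_bigcup_measurable.
rewrite AE setI_bigcupr !measure_fin_bigcup//; last 2 first.
- by move=> S S' AS AS' [u [[_ ?] [_ ?]]]; apply: tatom => //; exists u.
- by move=> S _; exact: measurableI.
rewrite ge0_mule_fsumr//; apply: eq_fsbigr => S _.
exact: (mutually_independent_fsetU1 D).
Qed.

(** * The law of the number of heads *)

Section coin_turning_law.
Context {d : measure_display} {T : measurableType d} {R : realType}.
Context {P : probability T R}.
Variable W : nat -> {RV P >-> bool}.
Hypothesis tW : turning_variables (R := R) harmonic_turning W.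

(** A sign is determined by the parity of the number of turns, so this is the event Y_n = -1. At
    time 0 it is false. *)
Definition tails n t := odd (\sum_(1 <= k < n.+1) W k t).
Definition heads N t := (\sum_(1 <= n < N.+1) ~~ tails n t)%N.

Let tailsS n t : tails n.+1 t = tails n t (+) W n.+1 t.
Proof. by rewrite /tails big_nat_recr//= oddD oddb. Qed.

Let headsS N t : heads N.+1 t = (heads N t + ~~ tails N.+1 t)%N.
Proof. by rewrite /heads big_nat_recr. Qed.

Let heads_le N t : (heads N t <= N)%N.
Proof.
elim: N => [|N IH]; first by rewrite /heads big_geq.
by rewrite headsS -addn1 leq_add// leq_b1.
Qed.

Lemma coin_turning_sumE N t :
  coin_turning_sum W N t = (2 * heads N t)%:R - N%:R :> R.
Proof.
elim: N => [|N IH].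
  by rewrite /coin_turning_sum /heads !big_geq// muln0 subr0.
rewrite /coin_turning_sum big_nat_recr//= -/(coin_turning_sum W N t) IH headsS.
rewrite /coin_turning -signr_odd -/(tails N.+1 t) mulnDr natrD -natr1.
by case: (tails _ _) => /=; rewrite ?expr1 ?expr0 ?muln0 ?muln1; ring.
Qed.

Let state N h c := [set t | heads N t = h /\ tails N t = c].

(** The state at time [N] is a function of the turns 1 to [N], hence independent of the next one. *)
Let state_W N h c b : measurable (state N h c) /\
  P (W N.+1 @^-1` [set b] `&` state N h c) =
  (P (W N.+1 @^-1` [set b]) * P (state N h c))%E.
Proof.
apply: (mutually_independent_determined [set n | (1 <= n)%N] W
  [fset n in iota 1 N]%fset N.+1) => //.
- by case: tW.
- by move=> n /=; rewrite !inE/= mem_iota => /andP[].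
- by rewrite !inE/= mem_iota add1n ltnn andbF.
move=> t t' tt'.
have tailsE n : (n <= N)%N -> tails n t = tails n t'.
  move=> nN; congr odd; apply: eq_big_nat => k /andP[k1 kn]; rewrite tt'//.
  by rewrite !inE/= mem_iota k1 add1n/= (leq_trans kn).
have headsE : heads N t = heads N t'.
  by apply: eq_big_nat => n /andP[_ nN]; rewrite tailsE.
by rewrite /state/= headsE tailsE.
Qed.

Let measurable_state N h c : measurable (state N h c).
Proof. exact: (state_W N h c true).1. Qed.

Let heads_state N h :
  [set t | heads N t = h] = state N h false `|` state N h true.
Proof.
apply/seteqP; split=> t /=; last by case=> -[].
by case E : (tails N t); [right|left].
Qed.

Let P_turn N : (0 < N)%N -> P (W N.+1 @^-1` [set true]) = (N.+1%:R^-1)%:E.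
Proof.
by move=> N0; rewrite tW.2// /harmonic_turning eqSS eqn0Ngt N0.
Qed.

Let mW n b : measurable (W n @^-1` [set b]).
Proof. by rewrite -[X in measurable X]setTI; exact: measurable_funPT. Qed.

Let WC n : W n @^-1` [set false] = ~` (W n @^-1` [set true]).
Proof. by apply/seteqP; split=> t /=; case: (W n t). Qed.

Let P_noturn N : (0 < N)%N ->
  P (W N.+1 @^-1` [set false]) = (1 - N.+1%:R^-1)%:E.
Proof. by move=> N0; rewrite WC probability_setC// P_turn. Qed.

Let P_first b : P (W 1 @^-1` [set b]) = (2^-1)%:E.
Proof.
have PT : P (W 1 @^-1` [set true]) = (2^-1)%:E.
  by rewrite tW.2// /harmonic_turning eqxx.
case: b => //; rewrite WC probability_setC// PT.
by rewrite -EFinB; congr EFin; lra.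
Qed.

(* The probability of [state N h false]; that of [state N h true] is
   [heads_law N (N - h)].  At [N = 1] the last formula would divide by [0], but
   it does not apply to any [h <= 1]. *)
Let heads_law (N h : nat) : R :=
  if h == 0%N then 0 else if h == N then (2 * N%:R)^-1
  else (2 * h%:R - 1) / (2 * N%:R * (N%:R - 1)).

(** This is the transition into heads with count [h.+1]: from heads without a turn, or from tails
    with a turn, both with count [h]. *)
Let heads_lawS N h : (0 < N)%N -> (h <= N)%N ->
  (1 - N.+1%:R^-1) * heads_law N h + N.+1%:R^-1 * heads_law N (N - h)%N =
  heads_law N.+1 h.+1.
Proof.
move=> N0 hN; rewrite /heads_law/= eqSS subn_eq0 leqNgt ltn_neqAle hN andbT.
have NR0 : N%:R != 0 :> R by rewrite pnatr_eq0 -lt0n.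
have NR1 : N%:R + 1 != 0 :> R by rewrite natr1 pnatr_eq0.
have [->|hnN] := eqVneq h N.
  rewrite subnn/= eqn0Ngt N0/= mulr0 addr0 -natr1.
  by field; rewrite NR1 NR0.
have hltN : (h < N)%N by rewrite ltn_neqAle hnN.
have [->|h0] := eqVneq h 0%N.
  rewrite subn0 eqxx mulr0 add0r -natr1/=.
  by field; rewrite NR1 addrK NR0.
have -> : ((N - h)%N == N) = false by apply/negbTE; lia.
rewrite /= natrB// -!natr1.
(* Here 0 < h < N, which forces N >= 2. *)
have NR2 : N%:R - 1 != 0 :> R.
  by rewrite subr_eq0 (eqr_nat _ _ 1); apply/eqP; lia.
by field; rewrite ?addrK ?NR0 ?NR1 ?NR2.
Qed.

(** If no heads have occurred by a positive time, the current sign is tails. This fails at time 0,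
    whence the successor. *)
Let state0 N h c t : state N.+1 h c t -> (h == 0%N) ==> c.
Proof.
by move=> [<- <-]; rewrite headsS; case: (tails _ _); rewrite ?implybT ?addn1.
Qed.

(** The count is taken before the new toss and the sign after it, so that conditioning on the turn
    leaves [h] unchanged on both sides. *)
Let P_step N h c : (0 < N)%N ->
  P ([set t | heads N t = h /\ tails N.+1 t = c]) =
  ((1 - N.+1%:R^-1)%:E * P (state N h c) +
   (N.+1%:R^-1)%:E * P (state N h (~~ c)))%E.
Proof.
move=> N0.
rewrite (_ : [set _ | _] = (W N.+1 @^-1` [set false] `&` state N h c) `|`
    (W N.+1 @^-1` [set true] `&` state N h (~~ c))).
  rewrite measureU; [|exact: measurableI|exact: measurableI|].
    rewrite -P_turn// -P_noturn//.
    by congr (_ + _)%E; exact: (state_W _ _ _ _).2.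
  by apply/seteqP; split=> // t [[/= -> _] []].
apply/seteqP; split=> t /=; rewrite tailsS.
  case: (W N.+1 t) => -[ht ct]; [right|left]; do 2 split => //.
    by rewrite -ct addbT negbK.
  by rewrite -ct addbF.
by case=> -[-> [-> ->]]; rewrite ?addbF ?addbT ?negbK.
Qed.

Let state_law N h : (0 < N)%N -> (h <= N)%N ->
  P (state N h false) = (heads_law N h)%:E /\
  P (state N h true) = (heads_law N (N - h)%N)%:E.
Proof.
(* The base case is N = 1, where the fair first turn decides the sign. *)
elim: N h => // -[_|N IH] h _ hN.
  have tails1 t : tails 1 t = W 1 t by rewrite /tails big_nat1 oddb.
  have heads1 t : heads 1 t = ~~ W 1 t by rewrite /heads big_nat1 tails1.
  have stateE c :
      state 1 h c = if (h == ~~ c)%N then W 1 @^-1` [set c] else set0.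
    apply/seteqP; split=> t; rewrite /state/= heads1 tails1.
      by move=> [<- <-]; rewrite eqxx.
    by case: eqP => [->|//] /= ->.
  rewrite !stateE; case: h hN {stateE} => [|[|//]] _ /=.
    by rewrite P_first measure0 /heads_law/= mulr1.
  by rewrite P_first measure0 /heads_law/= mulr1.
split.
  case: h hN => [_|h hN].
    rewrite (_ : state _ _ _ = set0) ?measure0//.
    by apply/seteqP; split => // t /state0.
  rewrite (_ : state _ _ _ =
      [set t | heads N.+1 t = h /\ tails N.+2 t = false]).
    have [Pf Pt] := IH h isT hN.
    by rewrite P_step//= Pf Pt -!EFinM -EFinD heads_lawS.
  apply/seteqP; split=> t -[ht tt]; split=> //.
    2: by rewrite headsS tt ht addn1.
  by move: ht; rewrite headsS tt addn1 => -[].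
(* A count of [N.+2] is incompatible with tails at that time, in agreement with [heads_law]
   vanishing at 0. *)
have [hN2|hN'] := ltnP N.+1 h.
  have -> : h = N.+2 by apply/eqP; rewrite eqn_leq hN.
  rewrite subnn (_ : state _ _ _ = set0) ?measure0//.
  apply/seteqP; split=> // t [+ tt]; rewrite headsS tt addn0 => hN1.
  by have := heads_le N.+1 t; rewrite hN1 ltnn.
rewrite (_ : state _ _ _ = [set t | heads N.+1 t = h /\ tails N.+2 t = true]).
  have [Pf Pt] := IH h isT hN'.
  rewrite P_step//= Pf Pt -!EFinM -EFinD; congr EFin.
  (* By the symmetry between heads and tails, the same recursion is read at the complementary
     count. *)
  have := heads_lawS N.+1 (N.+1 - h)%N isT (leq_subr _ _).
  by rewrite subKn// -subSn.
apply/seteqP; split=> t -[ht tt]; split=> //.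
  2: by rewrite headsS tt ht addn0.
by move: ht; rewrite headsS tt addn0.
Qed.

(** In the sum over both signs the numerators 2h - 1 and 2(N - h) - 1 add up to 2(N - 1), which
    removes the dependence on h. The numerator in the statement counts the cells of [0, N] adjacent
    to the node h. *)
Lemma coin_turning_heads_law N h : (0 < N)%N -> (h <= N)%N ->
  P [set t | heads N t = h] = (((h < N)%N + (0 < h)%N)%:R / (2 * N%:R))%:E.
Proof.
move=> N0 hN; rewrite heads_state.
rewrite measureU//; last first.
  by apply/seteqP; split=> // t [[_ tt] [_]]; rewrite tt.
have [Pf Pt] := state_law N h N0 hN.
apply: etrans (congr2 (fun x y => x + y)%E Pf Pt) _.
rewrite -EFinD; congr EFin.
rewrite /heads_law subn_eq0 leqNgt ltn_neqAle hN andbT.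
have N0R : N%:R != 0 :> R by rewrite pnatr_eq0 -lt0n.
have [->|hnN] := eqVneq h N.
  by rewrite eqn0Ngt N0/= addr0 div1r.
have hltN : (h < N)%N by rewrite ltn_neqAle hnN.
have [->|h0] := eqVneq h 0%N.
  by rewrite subn0 eqxx add0r div1r.
have -> : ((N - h)%N == N) = false by apply/negbTE; lia.
rewrite lt0n h0/= natrB//; have NR2 : N%:R - 1 != 0 :> R.
  by rewrite subr_eq0 (eqr_nat _ _ 1); apply/eqP; lia.
by field; rewrite ?N0R ?NR2.
Qed.

Lemma integral_coin_turning_mean (f : R -> R) N : (0 < N)%N ->
  measurable_fun [set: R] f -> bounded_fun f ->
  (\int[distribution P (coin_turning_mean W N)]_x (f x)%:E =
   ((2 * N%:R)^-1 * \sum_(0 <= h < N) (f ((2 * h)%:R / N%:R - 1)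
                                  + f ((2 * h.+1)%:R / N%:R - 1)))%:E)%E.
Proof.
move=> N0 mf bf.
pose x h : R := (2 * h)%:R / N%:R - 1.
have meanE t : coin_turning_mean W N t = x (heads N t).
  rewrite /coin_turning_mean coin_turning_sumE mulrBl divff//.
  by rewrite pnatr_eq0 -lt0n.
have mfX : measurable_fun [set: T] (f \o coin_turning_mean W N).
  exact: (measurableT_comp mf (measurable_coin_turning_mean (P := P) W N)).
rewrite integral_distribution//; last 2 first.
- exact/measurable_EFinP.
- apply: measurable_bounded_integrable => //.
    by rewrite (@le_lt_trans _ _ 1%E) ?probability_le1 ?ltry.
  case: bf => M [Mr bM]; exists M; split => // r Mr' t _.
  exact: (bM _ Mr').
have mheads h : measurable [set t | heads N t = h].
  by rewrite heads_state; exact: measurableU.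
have -> : [set: T] = \big[setU/set0]_(0 <= h < N.+1) [set t | heads N t = h].
  rewrite -bigcup_seq; apply/seteqP; split=> // t _.
  by exists (heads N t) => //=; rewrite mem_index_iota ltnS heads_le.
rewrite integral_bigsetU_EFin//=; last 3 first.
- exact: (iota_uniq 0 N.+1).
- by move=> h h' _ _ [t [/= -> ->]].
- by apply/measurable_EFinP; exact: measurable_funTS.
rewrite (eq_big_nat _ _ (F2 := fun h =>
   ((((h < N)%N + (0 < h)%N)%:R / (2 * N%:R)) * f (x h))%:E)); last first.
  move=> h /= hN; rewrite (eq_integral (fun=> (f (x h))%:E)).
    rewrite integral_cst// EFinM muleC; congr (_ * _)%E.
    exact: coin_turning_heads_law.
  by move=> t /[!inE]/= ht; rewrite meanE ht.
rewrite sumEFin; congr EFin; rewrite mulr_sumr.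
(* The indicator of [h < N] makes node [h] the left end of cell [h]; that of [0 < h] makes it the
   right end of cell [h - 1], whence the shift of the second sum. *)
under eq_bigr do rewrite natrD mulrDl mulrDl.
rewrite big_split/=; rewrite big_nat_recr//= ltnn !mul0r addr0.
rewrite [X in _ + X]big_nat_recl//= !mul0r add0r -big_split/=.
apply: eq_big_nat => h /andP[_ hN]; rewrite hN mulrDr.
by rewrite /x !div1r.
Qed.

End coin_turning_law.

Theorem theorem1 (R : realType) (d : measure_display) (T : measurableType d)
    (P : probability T R) (W : nat -> {RV P >-> bool}) :
  turning_variables harmonic_turning W ->
  weak_cvg (fun N => distribution P (coin_turning_mean W N))
           (uniform_prob (ltrN11 R)).
Proof.
move=> tW f cf bf; rewrite integral_uniform_prob//.
(* The length [1 - -1] is left unevaluated to match [trapezoid_cvg]; the two expressions are only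
   compared for N > 0. *)
apply: (@cvg_trans _ (((1 - -1)^-1 * ((1 - -1) / (2 * N%:R) *
    \sum_(0 <= h < N) (f (-1 + (1 - -1) * h%:R / N%:R) +
                       f (-1 + (1 - -1) * h.+1%:R / N%:R))))%:E
    @[N --> \oo])%E).
  apply: near_eq_cvg; near=> N.
  have N0 : (0 < N)%N by near: N; exact: nbhs_infty_gt.
  rewrite integral_coin_turning_mean//; last exact: continuous_measurable_fun.
  congr EFin; rewrite (_ : 1 - -1 = 2 :> R); last by rewrite opprK.
  rewrite !mulrA mulVf// mul1r; congr (_ * _).
  by apply: eq_bigr => h _; rewrite !natrM !(addrC (-1)).
apply: cvg_EFin; first by near=> N.
by apply: cvgMr; exact: (trapezoid_cvg f (-1) 1 cf (ltrN11 R)).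
Unshelve. all: by end_near. Qed.
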